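(* Fix $k\in\mathbb N$. Let $\overline B(W,k)$ be the standard Bratteli diagram with vertex sets $W_n=\{k,k+1,\ldots,k+n-1\}$, $n\in\mathbb N$, and exactly one edge from $j\in W_n$ to $i\in W_{n+1}$ if $i\ge j$, and no edge otherwise. Then $\overline B(W,k)$ admits uncountably many tail invariant probability measures $\nu_a$, $0\le a\le1$, where $\nu_a$ is the measure whose value on the cylinder set of every finite path from $k\in W_1$ to $j\in W_n$ is $$p_j^{(n,\infty,k)}=\frac{a^{j-k}}{(1+a)^{n+j-k}}\cdot\frac{1-a^{n+k-j+1}}{1-a},\qquad j=k,\ldots,k+n-1,\ n\in\mathbb N$$ (for $a=1$ the last fraction is understood as $n+k-j+1$, and $0^0=1$).
   Context: The path space $X_{\overline B(W,k)}$ is the set of infinite paths starting at the unique vertex $k\in W_1$, with topology generated by cylinder sets (infinite paths with a prescribed finite initial path). A Borel measure on it is tail invariant if it takes equal values on the cylinder sets of any two finite paths starting at level $1$ with the same terminal vertex. *)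

(* Defs.v *)
From HB Require Import structures.
From mathcomp Require Import all_boot all_order all_algebra.
From mathcomp Require Import all_classical all_reals all_analysis.

Set Implicit Arguments.
Unset Strict Implicit.
Unset Printing Implicit Defensive.

Import Order.TTheory GRing.Theory Num.Theory.

Local Open Scope classical_set_scope.

(** Levels are numbered from 1: [level k n] is the vertex set
    [W_n = {k, ..., k + n - 1}] for [n >= 1] ([level k 0] is empty). *)
Definition level (k n : nat) : pred nat := [pred j | k <= j < k + n].

(** Between two given vertices of consecutive levels there is at most one edge,
    so the edge set is a relation and a path is determined by the sequence of
    the vertices it visits. *)
Definition edge (k n : nat) : rel nat :=
  [rel j i | [&& level k n j, level k n.+1 i & j <= i]].

(** [path_vertex x n] is the vertex of the infinite path [x] in [W_(n+1)]. *)
Record path_space (k : nat) := PathSpace {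
  path_vertex :> nat -> nat;
  path_start : level k 1 (path_vertex 0);
  path_step : forall n, edge k n.+1 (path_vertex n) (path_vertex n.+1)
}.

(** [s] is the list of the [n] vertices of a finite path from level 1 to the
    vertex [j] of [W_n]; for [n = 1] this is the path without edges. *)
Definition finite_path (k n j : nat) (s : seq nat) : Prop :=
  [/\ 0 < n, size s = n, level k 1 (nth 0 s 0),
      forall i, i.+1 < n -> edge k i.+1 (nth 0 s i) (nth 0 s i.+1) &
      nth 0 s n.-1 = j].

Definition cylinder (k : nat) (s : seq nat) : set (path_space k) :=
  [set x | forall i, i < size s -> x i = nth 0 s i].

Definition cylinders (k : nat) : set (set (path_space k)) :=
  [set C | exists n j s, finite_path k n j s /\ C = cylinder s].
Arguments cylinders : clear implicits.

HB.instance Definition _ (k : nat) := gen_eqMixin (path_space k).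
HB.instance Definition _ (k : nat) := gen_choiceMixin (path_space k).

(** MathComp-Analysis requires measurable types to be pointed; the chosen point
    is the path that stays at the vertex [k]. *)
Lemma const_path_start (k : nat) : level k 1 k.
Proof. by rewrite /level /= leqnn addn1 ltnSn. Qed.

Lemma const_path_step (k n : nat) : edge k n.+1 k k.
Proof. by rewrite /edge /level /= leqnn !addnS !ltnS leq_addr -addnS leq_addr. Qed.

Definition const_path (k : nat) : path_space k :=
  @PathSpace k (fun=> k) (const_path_start k) (const_path_step k).

HB.instance Definition _ (k : nat) := isPointed.Build (path_space k) (const_path k).

HB.instance Definition _ (k : nat) :=
  @isSubBaseTopological.Build (path_space k) (set (path_space k)) (cylinders k) id.

Definition borel_path_space (k : nat) :=
  g_sigma_algebraType (@open (path_space k)).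

Section measures.
Context {R : realType} {k : nat}.
Implicit Types mu : probability (borel_path_space k) R.

Definition tail_invariant mu : Prop :=
  forall n j s t, finite_path k n j s -> finite_path k n j t ->
    mu (cylinder s) = mu (cylinder t).

(** A library measure is a function on all sets, constrained only on the
    measurable ones, so as mathematical objects two measures are the same when
    these restrictions are. *)
Definition borel_restriction mu
    (A : {A : set (borel_path_space k) | measurable A}) : \bar R :=
  mu (sval A).

End measures.

Local Open Scope ring_scope.

(** In a MathComp ring [0 ^+ 0 = 1]. The truncated subtractions are exact since
    [k <= j < k + n] for every vertex [j] of [W_n]. *)
Definition cyl_value (R : realType) (a : R) (k n j : nat) : R :=
  a ^+ (j - k) / (1 + a) ^+ (n + j - k) *
  (if a == 1 then (n + k - j + 1)%:R
   else (1 - a ^+ (n + k - j + 1)) / (1 - a)).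

(* Main.v *)
Require Import Defs.
From HB Require Import structures.
From mathcomp Require Import all_boot all_order all_algebra.
From mathcomp Require Import all_classical all_reals all_analysis.
From mathcomp Require Import ring lra zify.

(** A tail invariant probability measure is the same thing as a weight [w n j]
    on vertices (the common measure of the cylinders ending at [j] in [W_n])
    that is nonnegative, equals 1 at the root, and is harmonic: [w n j] is the
    sum of [w n.+1 i] over the successors [i >= j] of [j].  For the stated
    values put [m = j - k]; then [cyl_value a k n (k + m)] is
    [a ^+ m / (1 + a) ^+ (n + m)] times the geometric sum [1 + ... + a ^+ (n - m)]
    ([cyl_value_geometric]).  Since the successors of [j] are those of [j + 1]
    together with [j] itself, harmonicity reduces to one three-term identity
    between neighbouring vertices ([cyl_value_harmonic]).

    Every such weight is realised by a measure ([harmonic_probability]) without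
    an extension theorem: the unit interval is cut into nested half-open
    intervals, one for each finite path, the interval of a path ending at [j]
    in [W_n] having length [w n j]; harmonicity says precisely that the intervals
    of the one-step extensions fill up the interval of the path.  Sending a
    real to the infinite path whose intervals contain it pushes Lebesgue measure
    to the measure wanted, since the preimage of a cylinder is its interval
    ([descent_cylinder]).

    Cylinders, with the empty set, are stable under intersection and generate
    the Borel sets, so the values on cylinders determine the measure
    ([probability_cylinder_unique]).  Finally the cylinder ending at [k + 1] in
    [W_2] has measure [a / (1 + a) ^+ 2], an injective function of [a] on the
    unit interval ([cyl_value_inj]); a countable family of measures would make
    that interval countable, contradicting its Lebesgue measure. *)

Set Implicit Arguments.
Unset Strict Implicit.
Unset Printing Implicit Defensive.

Import Order.TTheory GRing.Theory Num.Theory.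
Local Open Scope classical_set_scope.
Local Open Scope ring_scope.

(** * The weights of the measures *)

Section cylinder_values.
Context {R : realType} (k : nat).
Implicit Types a b : R.

(** This form removes the exception at [a = 1] and the division by [1 - a]. *)
Lemma cyl_value_geometric a n m : (m <= n)%N ->
  cyl_value a k n (k + m) =
  a ^+ m / (1 + a) ^+ (n + m) * \sum_(i < (n - m).+1) a ^+ i.
Proof.
move=> mn; rewrite /cyl_value addKn.
have -> : (n + (k + m) - k = n + m)%N by lia.
have -> : (n + k - (k + m) + 1 = (n - m).+1)%N by lia.
congr (_ * _); case: eqP => [->|/eqP a1].
  rewrite (eq_bigr (fun=> 1)); last by move=> i _; rewrite expr1n.
  by rewrite sumr_const card_ord.
have a1' : 1 - a != 0 by rewrite subr_eq0 eq_sym.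
apply: (mulIf a1'); rewrite divfK//.
by rewrite -{1}(expr1n _ (n - m).+1) subrXX mulrC; congr (_ * _);
  apply: eq_bigr => i _; rewrite expr1n mul1r.
Qed.

Lemma cyl_value_ge0 a n j : 0 <= a <= 1 -> 0 <= cyl_value a k n j.
Proof.
move=> /andP[a0 a1]; rewrite /cyl_value mulr_ge0//.
  by rewrite divr_ge0// exprn_ge0// addr_ge0.
case: ifP => // _; rewrite divr_ge0 ?subr_ge0//.
exact: exprn_ile1.
Qed.

Lemma cyl_value_start a : 0 <= a -> cyl_value a k 1 k = 1.
Proof.
move=> a0; have a1 : 1 + a != 0 by apply: lt0r_neq0; lra.
rewrite -[X in cyl_value a k 1 X]addn0 cyl_value_geometric//.
by rewrite big_ord_recl big_ord1 !expr0 /= addn0 !expr1 mul1r mulVf.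
Qed.

(** The sum over the successors of [j] is the [j]-th term plus the sum over the
    successors of [j + 1], so it suffices to compare the weights of neighbouring
    vertices, going down from the vertex [k + n] just above [W_n], where the
    formula still gives the right value. *)
Lemma cyl_value_harmonic a n j : 0 <= a -> level k n j ->
  cyl_value a k n j = \sum_(j <= i < k + n.+1) cyl_value a k n.+1 i.
Proof.
move=> a0 /andP[kj jn].
have a1 : 1 + a != 0 by apply: lt0r_neq0; lra.
have main d m : cyl_value a k (m + d) (k + m) =
    \sum_(k + m <= i < k + (m + d).+1) cyl_value a k (m + d).+1 i.
  elim: d m => [|d IH] m.
    rewrite addn0 addnS big_nat1 !cyl_value_geometric//.
    rewrite subnn subSnn big_ord1 big_ord_recl big_ord1 /= !expr0 expr1 exprS.
    by field; rewrite expf_neq0.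
  rewrite big_ltn; last by lia.
  have -> : (m + d.+1 = m.+1 + d)%N by lia.
  rewrite -(addnS k m) -IH !cyl_value_geometric; try by lia.
  (* With [S] the geometric sum of [d + 1] terms and [x = a ^+ d.+1], what is left
     is [(1 + a) * (S + x) = (S + x + a * x) + a * S]. *)
  have -> : (m.+1 + d - m = d.+1)%N by lia.
  have -> : ((m.+1 + d).+1 - m = d.+2)%N by lia.
  have -> : (m.+1 + d - m.+1 = d)%N by lia.
  rewrite (addnS _ m) !addSn (exprS (1 + a) (m + d + m).+1) (exprS a m).
  rewrite (big_ord_recr d.+2) !(big_ord_recr d.+1) /= (exprS a d.+1).
  set S := \sum_(i < d.+1) _.
  by field; rewrite expf_neq0.
have jkn : (j - k <= n)%N by lia.
by have := main (n - (j - k))%N (j - k)%N; rewrite !subnKC.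
Qed.

(** The common value is [a / (1 + a) ^+ 2], and
    [a * (1 + b) ^+ 2 - b * (1 + a) ^+ 2 = (a - b) * (1 - a * b)]: either [a = b],
    or [a * b = 1], which forces [a = b = 1] in the unit interval. *)
Lemma cyl_value_inj a b : 0 <= a <= 1 -> 0 <= b <= 1 ->
  cyl_value a k 2 k.+1 = cyl_value b k 2 k.+1 -> a = b.
Proof.
move=> /andP[a0 a1] /andP[b0 b1].
have a1' : 1 + a != 0 by apply: lt0r_neq0; lra.
have b1' : 1 + b != 0 by apply: lt0r_neq0; lra.
have E (c : R) : 1 + c != 0 -> cyl_value c k 2 k.+1 = c / (1 + c) ^+ 2.
  move=> c1; rewrite -(addn1 k) cyl_value_geometric//.
  by rewrite big_ord_recl big_ord1 /= expr0 !expr1; field.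
rewrite !E// => /eqP; rewrite eqr_div ?expf_neq0// => /eqP ab.
have /eqP : (a - b) * (1 - a * b) = 0 by move: ab; rewrite !expr2; lra.
rewrite mulf_eq0 !subr_eq0 => /orP[/eqP//|/eqP ab1].
by nra.
Qed.

End cylinder_values.

(** * Coding paths by nested intervals *)

Section interval_coding.
Context {R : realType} {k : nat}.
Variable w : nat -> nat -> R.
Hypothesis w_ge0 : forall n j, 0 <= w n j.
Hypothesis w_start : w 1 k = 1.
Hypothesis w_harmonic : forall n j, level k n j ->
  w n j = \sum_(j <= i < k + n.+1) w n.+1 i.

(** If the interval of a finite path to [v] in [W_n] has right end [r], the
    extension to [i] receives the half-open interval from [r - tail n i] to
    [r - tail n i.+1]: the subintervals
    are laid out in increasing order of [i], flush with [r].  Their end points do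
    not depend on [v], and by harmonicity the left end of the one for [i = v] is
    [r - w n v], the left end of the interval of the path. *)
Definition tail n i : R := \sum_(i <= l < k + n.+1) w n.+1 l.

Lemma tail_ge0 n i : 0 <= tail n i.
Proof. by rewrite sumr_ge0. Qed.

Lemma tail_max n : tail n (k + n.+1) = 0.
Proof. by rewrite /tail big_geq. Qed.

Lemma tailS n i : (i < k + n.+1)%N -> tail n i = w n.+1 i + tail n i.+1.
Proof. by move=> ikn; rewrite /tail big_ltn. Qed.

Lemma tail_nincr n i j : (i <= j)%N -> tail n j <= tail n i.
Proof.
move=> ij; have [jn|nj] := leqP j (k + n.+1).
  by rewrite [leRHS]/tail (@big_cat_nat _ _ _ j)//= lerDr sumr_ge0.
by rewrite [leLHS]/tail big_geq ?(ltnW nj)// tail_ge0.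
Qed.

(** The search stops at the first subinterval whose right end exceeds [u].  As
    it runs over the vertices from [v] to [k + n - 1] and otherwise yields [k + n],
    the result is a successor of [v] for every real [u], inside the interval of
    the path or not. *)
Definition next_vertex n v (r u : R) : nat :=
  (v + find (fun t => (u < r - tail n (v + t).+1)%R) (iota 0 (k + n - v)))%N.

Lemma next_vertex_bounds n v r u : (v <= k + n)%N -> (v <= next_vertex n v r u <= k + n)%N.
Proof.
move=> vn; rewrite /next_vertex leq_addr /=.
set p := fun _ => _; have := find_size p (iota 0 (k + n - v)).
by rewrite size_iota; lia.
Qed.

Lemma next_vertex_itv n v (r u : R) : (v <= k + n)%N -> r - tail n v <= u < r ->
  r - tail n (next_vertex n v r u) <= u < r - tail n (next_vertex n v r u).+1.
Proof.
move=> vn /andP[ru ur]; have := next_vertex_bounds r u vn.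
rewrite /next_vertex; set p := fun _ => _; set s := iota _ _.
have szs : size s = (k + n - v)%N by rewrite size_iota.
move=> /andP[_ bnd]; apply/andP; split.
  case E : (find p s) => [|t]; first by rewrite addn0.
  have tp : (t < find p s)%N by rewrite E.
  have := before_find 0%N tp.
  rewrite nth_iota; last by lia.
  by rewrite /p add0n addnS => /negbT; rewrite -leNgt.
(* If the search fails it returns the last vertex, whose right end is [r]. *)
have [hs|/negbTE hs] := boolP (has p s).
  have := nth_find 0%N hs; rewrite nth_iota ?add0n//.
  by move: hs; rewrite has_find szs.
have := hasNfind (negbT hs); rewrite szs => ->.
by rewrite subnKC// -addnS tail_max subr0.
Qed.

Lemma next_vertex_unique n v (r u : R) j : (v <= j <= k + n)%N ->
  r - tail n j <= u < r - tail n j.+1 -> next_vertex n v r u = j.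
Proof.
move=> /andP[vj jn] /andP[ju uj]; set i := next_vertex _ _ _ _.
have vn := leq_trans vj jn.
have /(next_vertex_itv vn)/andP : r - tail n v <= u < r.
  by have := tail_nincr n vj; have := tail_ge0 n j.+1; lra.
rewrite -/i => -[iu ui]; clearbody i.
have [ij|ji|//] := ltngtP i j.
- suff : u < u by rewrite ltxx.
  by rewrite (lt_le_trans ui)// (le_trans _ ju)// lerB// tail_nincr.
- suff : u < u by rewrite ltxx.
  by rewrite (lt_le_trans uj)// (le_trans _ iu)// lerB// tail_nincr.
Qed.

(** The vertex reached in [W_(m+1)] and the right end of the interval of the path
    that leads to it. *)
Fixpoint descent (u : R) (m : nat) : nat * R :=
  if m is m'.+1 then
    let: (v, r) := descent u m' in
    let i := next_vertex m'.+1 v r u in (i, r - tail m'.+1 i.+1)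
  else (k, 1).

Lemma descentS u m : descent u m.+1 =
  let i := next_vertex m.+1 (descent u m).1 (descent u m).2 u in
  (i, (descent u m).2 - tail m.+1 i.+1).
Proof. by rewrite /=; case: (descent u m). Qed.

Arguments descent : simpl never.

Lemma descent_level u m : level k m.+1 (descent u m).1.
Proof.
elim: m => [|m IH]; first exact: const_path_start.
move: IH; rewrite descentS /level /= => IH.
have vn : ((descent u m).1 <= k + m.+1)%N by lia.
by have := next_vertex_bounds (descent u m).2 u vn; lia.
Qed.

Lemma descent_edge u m : edge k m.+1 (descent u m).1 (descent u m.+1).1.
Proof.
rewrite /edge /= -/(level k m.+2 _) -/(level k m.+1 _) !descent_level/=.
have := descent_level u m; rewrite descentS /level /= => /andP[_ vn].
have vn' := ltnW vn.
by have /andP[] := next_vertex_bounds (descent u m).2 u vn'.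
Qed.

Definition descent_path u : path_space k :=
  @PathSpace k (fun m => (descent u m).1) (const_path_start k)
    (descent_edge u).

(** The right end computed by [descent], as a function of the path alone; at
    level [m + 1] the interval of the path [x] is the half-open one from
    [right_end x m - w m.+1 (x m)] to [right_end x m]. *)
Definition right_end (x : nat -> nat) m : R :=
  1 - \sum_(t < m) tail t.+1 (x t.+1).+1.

Lemma right_endS x m : right_end x m.+1 = right_end x m - tail m.+1 (x m.+1).+1.
Proof. by rewrite /right_end big_ord_recr /= opprD addrA. Qed.

Lemma eq_right_end x y m : (forall i, (i <= m)%N -> x i = y i) ->
  right_end x m = right_end y m.
Proof.
by move=> xy; congr (1 - _); apply: eq_bigr => -[t tm] _ /=; rewrite xy.
Qed.

Lemma descent_right_end u m : (descent u m).2 = right_end (descent_path u) m.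
Proof.
elim: m => [|m IH]; first by rewrite /right_end big_ord0 subr0.
by rewrite right_endS -IH /= descentS.
Qed.

(** Forwards, each step of the descent stays inside a subinterval, whose length
    [tail n i - tail n i.+1] is the weight of its end vertex; backwards, the
    interval of a path lies inside that of its initial segment, and subintervals
    of different successors are disjoint. *)
Lemma descent_cylinder u (x : nat -> nat) m : 0 <= u < 1 ->
  x 0%N = k -> (forall i, (i < m)%N -> edge k i.+1 (x i) (x i.+1)) ->
  (forall i, (i <= m)%N -> descent_path u i = x i) <->
  right_end x m - w m.+1 (x m) <= u < right_end x m.
Proof.
move=> u01 x0; elim: m => [_|m IH xE].
  rewrite /right_end big_ord0 x0 w_start subr0 subrr u01; split=> // _ i.
  by rewrite leqn0 => /eqP ->; rewrite x0.
have {}IH := IH (fun i im => xE i (ltnW im)).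
have /andP[xm /andP[xm1 xmm]] := xE m (ltnSn m).
have wE : w m.+1 (x m) = tail m.+1 (x m) by apply: w_harmonic.
have x1n : (x m.+1 <= k + m.+1)%N by move: xm1; rewrite /level /=; lia.
have -> : right_end x m.+1 - w m.+2 (x m.+1) = right_end x m - tail m.+1 (x m.+1).
  by rewrite right_endS (@tailS m.+1 (x m.+1)) -?addnS//; [ring|lia].
rewrite right_endS; split=> [ux|ux].
  have ux' i : (i <= m)%N -> descent_path u i = x i by move=> im; exact/ux/ltnW.
  have := ux m.+1 (leqnn _); rewrite /descent_path /= descentS /=.
  rewrite descent_right_end (eq_right_end ux') (ux' m (leqnn m) : (descent u m).1 = _) => <-.
  apply: next_vertex_itv; first exact: leq_trans xmm x1n.
  by rewrite -wE; apply/IH.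
have {}IH : forall i, (i <= m)%N -> descent_path u i = x i.
  apply/IH; rewrite wE; have := tail_nincr m.+1 xmm.
  by have := tail_ge0 m.+1 (x m.+1).+1; move: ux => /andP[]; lra.
move=> i; rewrite leq_eqVlt ltnS => /predU1P[->|/IH//].
rewrite /descent_path /= descentS /=.
rewrite descent_right_end (eq_right_end IH) (IH m (leqnn m) : (descent u m).1 = _).
by apply: next_vertex_unique => //; rewrite xmm.
Qed.

Lemma right_end_le1 x m : right_end x m <= 1.
Proof. by rewrite lerBlDr lerDl sumr_ge0// => i _; exact: tail_ge0. Qed.

(** Left ends increase along a path because the intervals are nested.  This does
    not follow from [descent_cylinder], whose intervals may be empty. *)
Lemma left_end_ge0 (x : nat -> nat) m :
  x 0%N = k -> (forall i, (i < m)%N -> edge k i.+1 (x i) (x i.+1)) ->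
  0 <= right_end x m - w m.+1 (x m).
Proof.
move=> x0; elim: m => [_|m IH xE].
  by rewrite /right_end big_ord0 x0 w_start subr0 subrr.
apply: le_trans (IH (fun i im => xE i (ltnW im))) _.
have /andP[xm /andP[xm1 xmm]] := xE m (ltnSn m).
have -> : w m.+1 (x m) = tail m.+1 (x m) by apply: w_harmonic.
have := tail_nincr m.+1 xmm.
rewrite right_endS (@tailS m.+1 (x m.+1)); first by lra.
by move: xm1; rewrite /level /=; lia.
Qed.

End interval_coding.

(** * Cylinders and Borel sets *)

Section borel_sets.
Context {k : nat}.

Lemma finite_path_start : finite_path k 1 k [:: k].
Proof. by split => //=; exact: const_path_start. Qed.

Lemma cylinder_start : cylinder [:: k] = [set: path_space k].
Proof.
apply/seteqP; split=> // x _ [|//] _ /=.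
by have := path_start x; rewrite /level /=; lia.
Qed.

Lemma open_cylinder (C : set (path_space k)) : cylinders k C -> open C.
Proof.
by move=> kC; exists [set C]; rewrite ?bigcup_set1// => _ ->; exact: finI_from1.
Qed.

Lemma countable_cylinders : countable (cylinders k).
Proof.
apply: (@sub_countable _ _ _ (range (@cylinder k))).
  by apply: subset_card_le => _ [n [j [s [_ ->]]]]; exists s.
exact: card_le_trans (card_image_le _ _) (countableP _).
Qed.

(** There are countably many cylinders, so the base formed by their finite
    intersections is countable and an open set is a countable union of it. *)
Lemma measurable_cylinders : @measurable _ (borel_path_space k) = <<s cylinders k >>.
Proof.
apply/seteqP; split; last first.
  apply: smallest_sub; first exact: smallest_sigma_algebra.
  by move=> C /open_cylinder oC; apply: sub_sigma_algebra.
apply: smallest_sub; first exact: smallest_sigma_algebra.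
move=> _ [B sB <-].
suff : @measurable _ (g_sigma_algebraType (cylinders k)) (\bigcup_(i in B) i) by [].
rewrite bigcup_set_type.

apply: countable_bigcupT_measurable => [|[i iB]].
  rewrite (eq_countable (card_setT B)).
  have cF := finI_from_countable id countable_cylinders.
  exact: sub_countable (subset_card_le sB) cF.
have /= [F sF <-] := sB i (set_mem iB).
apply: fin_bigcap_measurable => // C CF.
by apply: sub_sigma_algebra; apply/set_mem/sF.
Qed.

(** Of two cylinders with a common point, the one given by the longer path is
    contained in the other. *)
Lemma setI_closed_cylinders : setI_closed (set0 |` cylinders k).
Proof.
have meet A B : cylinders k A -> cylinders k B ->
    (set0 |` cylinders k) (A `&` B).
  move=> [m [i [s [fs ->]]]] [n [j [t [ft ->]]]].
  have [[x [sx tx]]|noI] := pselect ((cylinder s : set (path_space k)) `&` cylinder t !=set0); last first.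
    by left; apply/seteqP; split=> // x [sx tx]; case: noI; exists x.
  right; wlog st : m n i j s t fs ft sx tx / (size s <= size t)%N => [wlg|].
    have [st|ts] := leqP (size s) (size t); first exact: wlg fs ft sx tx st.
    by rewrite setIC; exact: wlg ft fs tx sx (ltnW ts).
  exists n, j, t; split=> //; apply/setIidPr => y ty l ls.
  have lt := leq_trans ls st.
  by rewrite ty// -tx// sx.
move=> A B [->|kA] [->|kB]; rewrite ?set0I ?setI0; try by left.
exact: meet.
Qed.

Lemma probability_cylinder_unique (R : realType)
    (mu nu : probability (borel_path_space k) R) :
  (forall n j s, finite_path k n j s -> mu (cylinder s) = nu (cylinder s)) ->
  borel_restriction mu = borel_restriction nu.
Proof.
move=> munu; apply/funext => -[A mA]; rewrite /borel_restriction /=.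
have setTE : cylinders k setT.
  by exists 1%N, k, [:: k]; split; [exact: finite_path_start|rewrite cylinder_start].
apply: (@measure_unique _ _ (borel_path_space k) (set0 |` cylinders k) (fun=> setT) _ _ _ _ mu nu) => //.
- rewrite measurable_cylinders; apply/seteqP; split.
    apply: smallest_sub; first exact: smallest_sigma_algebra.
    by move=> B kB; apply: sub_sigma_algebra; right.
  apply: smallest_sub; first exact: smallest_sigma_algebra.
  move=> B [->|kB]; last exact: sub_sigma_algebra.
  exact: sigma_algebra0.
- exact: setI_closed_cylinders.
- by move=> _; right.
- by rewrite bigcup_const//; exists 0%N.
- by move=> B [->|[n [j [s [fs ->]]]]]; [rewrite !measure0|exact: munu fs].
- by move=> _; apply: le_lt_trans (probability_le1 mu measurableT) _; rewrite ltry.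
Qed.

End borel_sets.

(** * The measure of a harmonic weight *)

Section harmonic_measure.
Context {R : realType}.

Definition unit_lebesgue : set (measurableTypeR R) -> \bar R :=
  mrestr (@lebesgue_measure R) (measurable_itv `[0, 1[%R).

HB.instance Definition _ := Measure.on unit_lebesgue.

Lemma unit_lebesgue_setT : unit_lebesgue setT = 1%E.
Proof.
by rewrite /unit_lebesgue /mrestr setTI lebesgue_measure_itv/= lte_fin ltr01 sube0.
Qed.

HB.instance Definition _ :=
  Measure_isProbability.Build _ _ _ unit_lebesgue unit_lebesgue_setT.

Lemma harmonic_probability k (w : nat -> nat -> R) :
  (forall n j, 0 <= w n j) -> w 1 k = 1 ->
  (forall n j, level k n j ->
    w n j = \sum_(j <= i < k + n.+1) w n.+1 i) ->
  exists mu : probability (borel_path_space k) R,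
    forall n j s, finite_path k n j s -> mu (cylinder s) = (w n j)%:E.
Proof.
move=> w0 w1 wh.
pose D : set R := `[0, 1[%classic.
(* Outside the unit interval, which has no mass, the path is constant, so that
   the preimages of cylinders are also controlled there. *)
pose f (u : measurableTypeR R) : borel_path_space k :=
  if u \in D then descent_path w u else const_path k.
have fE n j s : finite_path k n j s -> exists2 b : R,
    D `&` f @^-1` cylinder s = `[b - w n j, b[%classic & 0 <= b - w n j /\ b <= 1.
  case: n => [|n] [//_ ss s0 sE <-].
  pose x := nth 0%N s.
  have x0 : x 0%N = k by move: s0; rewrite /level /= -/x; lia.
  have l0 := left_end_ge0 w0 w1 wh x0 sE.
  have r1 := right_end_le1 (k := k) w0 x n.
  exists (right_end (k := k) w x n) => //.
  apply/seteqP; split=> u /=; rewrite !in_itv/=.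
    move=> [uD]; rewrite /f mem_set//= => us.
    apply/(descent_cylinder w0 w1 wh uD x0 sE) => i i_n.
    by apply: us; rewrite ss.
  move=> u_itv; have uD : 0 <= u < 1.
    move: u_itv => /andP[lu ur].
    by rewrite (le_trans l0 lu) (lt_le_trans ur r1).
  split=> //; rewrite /f mem_set/= ?in_itv//= => i; rewrite ss => i_n.
  by apply: (descent_cylinder w0 w1 wh uD x0 sE).2.
have mf : measurable_fun setT f.
  apply: (measurability _ (measurable_cylinders (k := k))) => _ [_ [n [j [s [fs ->]]]] <-].
  have [b fb _] := fE _ _ _ fs.
  rewrite setTI -(setUIDK (f @^-1` _) D) setIC fb setDE; apply: measurableU => //.
  rewrite setIC; have [ks|ks] := pselect (cylinder s (const_path k)).
    rewrite (_ : _ `&` _ = ~` D); first by apply: measurableC; exact: measurable_itv.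
    apply/seteqP; split=> u; first by case.
    by move=> uD; split => //; rewrite /f /= memNset.
  rewrite (_ : _ `&` _ = set0)// -subset0 => u [uD].
  by rewrite /f /= memNset.
pose mu := distribution unit_lebesgue (mfun_Sub (mem_set mf)).
exists mu => n j s fs.
have [b fb [b0 b1]] := fE _ _ _ fs.
rewrite /mu /= /distribution /pushforward /unit_lebesgue /mrestr /= setIC.
rewrite fb lebesgue_measure_itv /= lte_fin gtrBl -EFinB.
have -> : b - (b - w n j) = w n j by ring.
by have := w0 n j; rewrite le_eqVlt => /predU1P[<-|->//]; rewrite ltxx.
Qed.
End harmonic_measure.

(** * Uncountably many tail invariant measures *)

Theorem proposition8p15 (R : realType) (k : nat) :
  exists nu : R -> probability (borel_path_space k) R,
    (forall a : R, 0 <= a <= 1 ->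
      [/\ tail_invariant (nu a),
          forall (n j : nat) (s : seq nat), finite_path k n j s ->
            nu a (cylinder s) = (cyl_value a k n j)%:E
        & forall mu : probability (borel_path_space k) R,
            (forall (n j : nat) (s : seq nat), finite_path k n j s ->
              mu (cylinder s) = (cyl_value a k n j)%:E) ->
            borel_restriction mu = borel_restriction (nu a)]) /\
    ~ countable [set borel_restriction (nu a) | a in [set a : R | 0 <= a <= 1]].
Proof.
(* [nu] is indexed by all reals; outside the unit interval its values are
   arbitrary. *)
have nuP (a : R) : exists mu : probability (borel_path_space k) R,
    0 <= a <= 1 -> forall n j s, finite_path k n j s ->
      mu (cylinder s) = (cyl_value a k n j)%:E.
  have [a01|a01] := boolP (0 <= a <= 1); last first.
    by exists (dirac (const_path k : borel_path_space k)).
  have a0 : 0 <= a by case/andP: a01.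
  have [mu muP] := harmonic_probability (fun n j => cyl_value_ge0 k n j a01)
    (cyl_value_start k a0) (fun n j => cyl_value_harmonic a0).
  by exists mu.
have [nu {}nuP] := choice nuP.
exists nu; split=> [a a01|cnt].
  split=> [n j s t fs ft|n j s|mu muP].
  - by rewrite !(nuP a a01 n j).
  - exact: nuP.
  - apply: probability_cylinder_unique => n j s fs.
    by rewrite (muP _ _ _ fs) (nuP a a01 _ _ _ fs).
have : lebesgue_measure (`[0, 1]%classic : set R) = 0%E.
  apply: countable_lebesgue_measure0.
  rewrite set_itvcc; move: cnt; rewrite (eq_countable (inj_card_eq _)) // => a b.
  rewrite !inE => a01 b01 nuab; apply: (cyl_value_inj a01 b01 (k := k)).
  have fk : finite_path k 2 k.+1 [:: k; k.+1].
    split=> // [|[|i]//] /=; first exact: const_path_start.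
    by rewrite /edge /level /=; lia.
  have mC : measurable (cylinder [:: k; k.+1] : set (borel_path_space k)).
    rewrite measurable_cylinders; apply: sub_sigma_algebra.
    by exists 2%N, k.+1, [:: k; k.+1].
  have := congr1 (fun m => m (exist _ _ mC)) nuab.
  by rewrite /borel_restriction/= (nuP a a01 _ _ _ fk) (nuP b b01 _ _ _ fk) => -[].
by rewrite lebesgue_measure_itv/= lte_fin ltr01 sube0 => /eqP; rewrite onee_eq0.
Qed.
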